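(* For $k>d$, let $P_1,\dots,P_k$ be pairwise disjoint finite sets in $\mathbb{R}^d$ such that $P_1\cup\cdots\cup P_k$ is in general position. Then there are subsets $P_1'\subset P_1,\dots,P_k'\subset P_k$ such that the $k$-tuple $(P_1',\dots,P_k')$ has same-type transversals and $$|P_i'|\ \ge\ 2^{-O(d^3k\log k)}\,|P_i|$$ for all $i$, where the constant implied by $O(\cdot)$ is absolute (independent of $d$, $k$ and the sets).
   Context: A point set in $\mathbb{R}^d$ is in general position if no $d+1$ of its points lie in a common hyperplane. For a sequence $(p_1,\dots,p_n)$ of points of $\mathbb{R}^d$ in general position, the orientation of a $(d+1)$-tuple $(p_{i_1},\dots,p_{i_{d+1}})$, $i_1<\cdots<i_{d+1}$, is the sign of the determinant of the $(d+1)\times(d+1)$ matrix whose $j$-th column is $(1,p_{i_j})^{T}$, i.e. a $1$ followed by the coordinates of $p_{i_j}$. The order-type of $(p_1,\dots,p_n)$ is the map assigning to each $(d+1)$-tuple of indices $i_1<\cdots<i_{d+1}$ the orientation ($+1$ or $-1$) of $(p_{i_1},\dots,p_{i_{d+1}})$; two sequences of length $n$ have the same order-type if these maps agree. A transversal of $(P_1,\dots,P_k)$ is a $k$-tuple $(p_1,\dots,p_k)$ with $p_i\in P_i$ for all $i$. $(P_1,\dots,P_k)$ has same-type transversals if all of its transversals have the same order-type. *)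

(* Defs.v *)
From mathcomp Require Import all_boot all_order all_algebra.
From mathcomp Require Import finmap.
From mathcomp Require Import reals exp.

Set Implicit Arguments.
Unset Strict Implicit.
Unset Printing Implicit Defensive.

Import Order.TTheory GRing.Theory Num.Theory.
Local Open Scope ring_scope.
Local Open Scope fset_scope.

Section Defs.
Context {R : realType} {d : nat}.

Definition in_common_hyperplane (S : {fset 'cV[R]_d}) : Prop :=
  exists (a : 'cV[R]_d) (b : R),
    a != 0 /\ forall x, x \in S -> \sum_(i < d) a i 0 * x i 0 = b.

Definition general_position (A : {fset 'cV[R]_d}) : Prop :=
  forall S : {fset 'cV[R]_d},
    S `<=` A -> #|` S| = d.+1 -> ~ in_common_hyperplane S.

(* Column j is a 1 followed by the coordinates of q j; the type of col_mx is  *)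
(* 'cV_(1 + d), convertible to 'cV_d.+1.                                      *)
Definition orientation (q : 'I_d.+1 -> 'cV[R]_d) : R :=
  Num.sg (\det (\matrix_(i < d.+1, j < d.+1)
                  (col_mx (1 : 'cV[R]_1) (q j) : 'cV[R]_d.+1) i 0)).

(* A tuple of indices i_1 < ... < i_(d+1) is a strictly increasing map        *)
(* f : 'I_d.+1 -> 'I_k.                                                       *)
Definition same_order_type {k : nat} (p q : 'I_k -> 'cV[R]_d) : Prop :=
  forall f : 'I_d.+1 -> 'I_k,
    {homo f : i j / (i < j)%N} ->
    orientation (p \o f) = orientation (q \o f).

Definition transversal {k : nat} (P : 'I_k -> {fset 'cV[R]_d})
    (p : 'I_k -> 'cV[R]_d) : Prop :=
  forall i, p i \in P i.

Definition same_type_transversals {k : nat}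
    (P : 'I_k -> {fset 'cV[R]_d}) : Prop :=
  forall p q, transversal P p -> transversal P q -> same_order_type p q.

End Defs.

(* Main.v *)
Require Import Defs.
From mathcomp Require Import all_boot all_order all_algebra.
From mathcomp Require Import finmap.
From mathcomp Require Import reals exp.
From mathcomp Require Import zify ring lra.

Set Implicit Arguments.
Unset Strict Implicit.
Unset Printing Implicit Defensive.

Import Order.TTheory GRing.Theory Num.Theory.

(** Write each point p of the d-space as the row vector (1, p); an orientation
is then the sign of a determinant that is linear in each of its d+1 rows, so if
its weak sign is constant on finite sets V_1, ..., V_(d+1) of vectors, it is
constant on the positive cones that they span. The sets P_1, ..., P_k are
treated one after the other. When P_i is treated, it is replaced by a subset X
lying in the open cone spanned by a set W of d+1 vectors, and from then on W
stands for the i-th set. Each set is thus shrunk only once, and what has to be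
controlled is the proportion of bad transversals: those for which some
orientation is not yet determined, in the weak sense, when the sets already
treated range over their vectors and the other points are those of the
transversal ([weakly_typed]).

Fixing a transversal and a vector for each treated set turns every orientation
that involves the i-th set into a linear functional of its i-th point. A
transversal that was determined stays determined unless one of these functionals
takes both signs on W ([weakly_typed_step]): a functional of constant weak sign
on W has that same sign at any point of the open cone over W.

The cones come from a cutting of the space by a random sample of these
functionals. In the arrangement of the sample and of the coordinate functionals,
every vector is a positive combination of extremal rays of the closure of its
cell, at most d+1 of them ([extremal_ray_decomposition]), and each ray is the
common kernel of d members of the arrangement ([extremal_ray_multiple]). A cone
is therefore described by at most d(d+1) members of the sample; a cone that is
crossed by a proportion larger than 1/M of all the functionals is very unlikely
to be crossed by none of the other members, and a union bound over the
descriptions gives a sample for which this never happens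
([exists_cutting_sample]). The number of cones is polynomial in the size of the
sample, with exponent d(d+1).

Averaging over the cones selects one that contains a large part of P_i and in
which the proportion of bad transversals at most doubles
([exists_large_quiet_part]); the crossing functionals add at most 1/E to it. With
E = 2^(k+1), after k steps the proportion is at most (2^(k+1) - 1)/E < 1, so some
transversal is determined, and this says exactly that all orientations have
constant weak sign ([weak_same_type]). General position makes the signs strict.
A sample of size 2^(O(k log k)) suffices, so every set keeps a proportion
2^(-O(d^2 k log k)) of its points ([sampling_parameters]), which is even better
than the required bound. *)

(** * Extremal rays of the cells of a linear arrangement *)

Local Open Scope ring_scope.

Section Faces.
Context {R : realFieldType} {n m : nat} (H : 'M[R]_(n, m)).
Implicit Types x y z : 'rV[R]_n.

Definition vanishing_columns x : 'M[R]_(n, m) :=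
  \matrix_(i, l) if (x *m H) 0 l == 0 then H i l else 0.

(** The columns of H are linear functionals. This is the linear span of the relatively
open cell of x in their arrangement, as a row space. *)
Definition face x : 'M[R]_n := kermx (vanishing_columns x).

(** The vector y lies in the closure of the relatively open cell of x. *)
Definition in_sign_cell x y : Prop :=
  (y <= face x)%MS /\ forall l, 0 <= (x *m H) 0 l * (y *m H) 0 l.

Lemma sub_faceP x y :
  reflect (forall l, (x *m H) 0 l = 0 -> (y *m H) 0 l = 0) (y <= face x)%MS.
Proof.
have E l : (y *m vanishing_columns x) 0 l =
    if (x *m H) 0 l == 0 then (y *m H) 0 l else 0.
  case: eqP => xl; rewrite [LHS]mxE; last first.
    rewrite big1 // => i _; rewrite [vanishing_columns _ _ _]mxE.
    by case: eqP => //; rewrite mulr0.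
  rewrite [RHS]mxE; apply: eq_bigr => i _.
  by rewrite [vanishing_columns _ _ _]mxE xl eqxx.
apply: (iffP sub_kermxP) => [yZ l xl|h].
  by move/rowP: yZ => /(_ l); rewrite E xl eqxx [RHS]mxE.
by apply/rowP=> l; rewrite E [RHS]mxE; case: eqP => // /h.
Qed.

Lemma mem_face x : (x <= face x)%MS.
Proof. exact/sub_faceP. Qed.

Lemma face_subset x y : (y <= face x)%MS -> (face y <= face x)%MS.
Proof.
move/sub_faceP => xy; apply/row_subP => i; apply/sub_faceP => l xl.
by have /sub_faceP := row_sub i (face y); apply; apply: xy.
Qed.

(** Each time a vector is moved onto a new hyperplane of the arrangement its cell
loses a dimension: x itself witnesses that the inclusion of spans is strict. All
inductions below are on this rank. *)
Lemma face_rank_lt x y l : (y <= face x)%MS ->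
  (x *m H) 0 l != 0 -> (y *m H) 0 l = 0 -> (\rank (face y) < \rank (face x))%N.
Proof.
move=> yx xl yl; apply: rank_ltmx; rewrite /ltmx face_subset //=.
apply: contraL (xl) => /(submx_trans (mem_face x)) /sub_faceP h.
by rewrite negbK; apply/eqP/h.
Qed.

Lemma in_sign_cell_trans x y z :
  in_sign_cell x y -> in_sign_cell y z -> in_sign_cell x z.
Proof.
move=> [yx sxy] [zy syz]; split; first exact: submx_trans zy (face_subset yx).
move=> l; move: (sxy l) (syz l).
have [y0|y0] := eqVneq ((y *m H) 0 l) 0.
  by move/sub_faceP: zy => /(_ _ y0) ->; rewrite !mulr0.
move=> h1 h2; have := mulr_ge0 h1 h2.
have -> (a b c : R) : a * b * (b * c) = b ^+ 2 * (a * c) by ring.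
by rewrite pmulr_rge0 // exprn_even_gt0.
Qed.

Hypothesis Hfree : row_free H.

(** If the functionals have full rank, the arrangement is pointed: only the origin
lies on all hyperplanes. *)
Lemma nonzero_value x : x != 0 -> exists l, (x *m H) 0 l != 0.
Proof.
move=> x0; apply/existsP; apply: contraNT x0 => /existsPn h.
apply/eqP/(row_free_inj Hfree); rewrite /= mul0mx; apply/rowP => l.
by rewrite [RHS]mxE; apply/eqP; move: (h l); rewrite negbK.
Qed.

Lemma face_rank_gt0 x : x != 0 -> (0 < \rank (face x))%N.
Proof.
by move=> x0; have := mxrankS (mem_face x); rewrite rank_rV x0.
Qed.

Lemma valueDZ x y a l : ((x - a *: y) *m H) 0 l = (x *m H) 0 l - a * (y *m H) 0 l.
Proof. by rewrite mulmxBl -scalemxAl !mxE. Qed.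

Lemma valueZ y a l : ((a *: y) *m H) 0 l = a * (y *m H) 0 l.
Proof. by rewrite -scalemxAl !mxE. Qed.

(** If the cell of x is more than a ray, its span contains some u that is not a
multiple of x, and subtracting from u the right multiple of x gives a nonzero
vector on the boundary of the cell. *)
Lemma extremal_ray_in_cell x : x != 0 ->
  exists y, [/\ y != 0, in_sign_cell x y & \rank (face y) = 1%N].
Proof.
have [r] := ubnP (\rank (face x)); elim: r x => // r IHr x rx x0.
have [r1|r1] := eqVneq (\rank (face x)) 1%N.
  by exists x; split=> //; split=> [|l]; rewrite ?mem_face // -expr2 sqr_ge0.
have : ~~ (face x <= x)%MS.
  apply: contra r1 => /mxrankS; rewrite rank_rV x0 /= => h.
  by rewrite eqn_leq h face_rank_gt0.
case/row_subPn => i ux; set u := row i _ in ux.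
have uf : (u <= face x)%MS by exact: row_sub.
have [l0 xl0] := nonzero_value x0.
pose ratio l := (u *m H) 0 l / (x *m H) 0 l.
(* With the least ratio u/x over the functionals that do not vanish at x, the
difference u - ratio * x has everywhere the weak sign of x, and it vanishes
where the minimum is attained. *)
have [l xl lmin] := @Order.TotalTheory.arg_minP _ _ _ l0
  (fun l => (x *m H) 0 l != 0) ratio xl0.
pose y := u - ratio l *: x.
have yE j : (y *m H) 0 j = (u *m H) 0 j - ratio l * (x *m H) 0 j by exact: valueDZ.
have yx : in_sign_cell x y.
  split.
    by apply/sub_faceP => j xj; rewrite yE xj mulr0 subr0; exact: (sub_faceP _ _ uf).
  move=> j; have [->|xj] := eqVneq ((x *m H) 0 j) 0; first by rewrite mul0r.
  rewrite yE -(divfK xj ((u *m H) 0 j)) -/(ratio j).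
  rewrite -mulrBl mulrCA mulr_ge0 ?subr_ge0 ?lmin //.
  by rewrite -expr2 sqr_ge0.
have y0 : y != 0.
  by apply: contra ux; rewrite subr_eq0 => /eqP ->; apply: scalemx_sub.
have yl : (y *m H) 0 l = 0 by rewrite yE /ratio divfK ?subrr.
have [|y' [y'0 yy' ry']] := IHr y _ y0.
  by have := face_rank_lt yx.1 xl yl; move: rx; rewrite ltnS => h1 h2; apply: leq_trans h2 h1.
by exists y'; split=> //; apply: in_sign_cell_trans yy'.
Qed.

(** Greedy form of the conic Caratheodory theorem: remove from x the largest
multiple of an extremal ray that keeps it in its closed cell, which lowers the
dimension of the cell. Since positive multiples of extremal rays are extremal,
the coefficients are absorbed in the vectors. *)
Lemma extremal_ray_decomposition x :
  exists vs : seq 'rV[R]_n, [/\ (size vs <= \rank (face x))%N,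
    x = \sum_(v <- vs) v &
    forall v, v \in vs -> [/\ v != 0, in_sign_cell x v & \rank (face v) = 1%N]].
Proof.
have [r] := ubnP (\rank (face x)); elim: r x => // r IHr x rx.
have [->|x0] := eqVneq x 0; first by exists [::]; rewrite big_nil.
have [y [y0 xy ry]] := extremal_ray_in_cell x0.
pose ratio l := (y *m H) 0 l / (x *m H) 0 l.
have [l0 yl0] := nonzero_value y0.
have xl0 : (x *m H) 0 l0 != 0.
  by apply: contra yl0 => /eqP xl; rewrite (sub_faceP _ _ xy.1).
have [l xl lmax] := @Order.TotalTheory.arg_maxP _ _ _ l0
  (fun l => (x *m H) 0 l != 0) ratio xl0.
have ratio_ge0 j : 0 <= ratio j.
  have [e|xj] := eqVneq ((x *m H) 0 j) 0; first by rewrite /ratio e invr0 mulr0.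
  have -> : ratio j = (x *m H) 0 j * (y *m H) 0 j / ((x *m H) 0 j) ^+ 2.
    by rewrite /ratio; field.
  by rewrite divr_ge0 ?sqr_ge0 // xy.2.
have rl : 0 < ratio l.
  apply: lt_le_trans (lmax l0 xl0); rewrite lt_def ratio_ge0 andbT.
  by rewrite mulf_neq0 ?invr_eq0.
pose v := (ratio l)^-1 *: y; pose x' := x - v.
have vE j : (v *m H) 0 j = (ratio l)^-1 * (y *m H) 0 j by exact: valueZ.
have x'E j : (x' *m H) 0 j = (x *m H) 0 j - (ratio l)^-1 * (y *m H) 0 j.
  exact: valueDZ.
have vy l1 : ((v *m H) 0 l1 == 0) = ((y *m H) 0 l1 == 0).
  by rewrite vE mulf_eq0 invr_eq0 gt_eqF.
have facev : face v = face y.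
  by congr kermx; apply/matrixP=> i j; rewrite [LHS]mxE [RHS]mxE vy.
have xv : in_sign_cell x v.
  split; first by apply: scalemx_sub; exact: xy.1.
  by move=> j; rewrite vE mulrCA mulr_ge0 ?invr_ge0 ?(ltW rl) ?xy.2.
have xx' : in_sign_cell x x'.
  split.
    apply/sub_faceP => j xj; rewrite x'E xj sub0r.
    by rewrite (sub_faceP _ _ xy.1) // mulr0 oppr0.
  move=> j; have [->|xj] := eqVneq ((x *m H) 0 j) 0; first by rewrite mul0r.
  have -> : (x *m H) 0 j * (x' *m H) 0 j = ((x *m H) 0 j)^+2 * (1 - ratio j / ratio l).
    by rewrite x'E /(ratio j); field; rewrite xj gt_eqF.
  by rewrite mulr_ge0 ?sqr_ge0 // subr_ge0 ler_pdivrMr // mul1r; exact: lmax.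
have x'l : (x' *m H) 0 l = 0.
  rewrite x'E /ratio invf_div divfK ?subrr //.
  by move: rl; rewrite /ratio; apply: contraTneq => ->; rewrite mul0r ltxx.
have rx' := face_rank_lt xx'.1 xl x'l.
have [|vs [svs x'vs Hvs]] := IHr x'; first exact: leq_trans rx' rx.
exists (v :: vs); split.
- exact: leq_ltn_trans svs rx'.
- by rewrite big_cons -x'vs addrC subrK.
- move=> w; rewrite inE => /orP[/eqP->|/Hvs [w0 x'w rw]].
    split=> //; last by rewrite facev.
    by rewrite scaler_eq0 negb_or invr_eq0 gt_eqF.
  by split=> //; apply: in_sign_cell_trans x'w.
Qed.

End Faces.

(** * Cones with a bounded description *)

Section Cells.
Context {R : realFieldType} {d : nat}.

(** When the common kernel of the d functionals is a line, this vector spans it. *)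
Definition ray (G : 'M[R]_(d.+1, d)) : 'rV[R]_d.+1 := nz_row (kermx G).

(** Among the functionals vanishing at v, which have rank d, d independent ones
already have the line of v as common kernel. So an extremal ray is described by d
functionals, whatever their total number; this is what makes the union bound of
[exists_cutting_sample] affordable. *)
Lemma extremal_ray_multiple m (H : 'M[R]_(d.+1, m)) (v : 'rV[R]_d.+1) :
  v != 0 -> \rank (face H v) = 1%N ->
  exists (T : {ffun 'I_d -> 'I_m}) (a : R), v = a *: ray (colsub T H).
Proof.
move=> v0; rewrite /face mxrank_ker; set Z := vanishing_columns H v => rZ.
have rd : \rank Z^T = d by rewrite mxrank_tr; have := rank_leq_row Z; lia.
pose T : {ffun 'I_d -> 'I_m} := [ffun j => maxrankfun Z^T (cast_ord (esym rd) j)].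
(* The chosen columns of the masked matrix are independent, hence nonzero, so
they are columns of H whose functionals vanish at v. *)
have rT : \rank (colsub T Z) = d.
  rewrite -mxrank_tr -[RHS]rd -(eq_maxrowsub Z^T).
  have -> : (colsub T Z)^T = castmx (rd, erefl) (rowsub (maxrankfun Z^T) Z^T).
    by apply/matrixP => i j; rewrite castmxE !mxE ffunE cast_ord_id.
  by rewrite eqmx_cast.
have vT j : (v *m H) 0 (T j) = 0.
  apply/eqP; apply: contraTT isT => vTj.
  have : row_free (colsub T Z)^T by rewrite /row_free mxrank_tr rT.
  move/row_free_inj/(_ (delta_mx 0 j : 'rV_d) 0).
  rewrite /= mul0mx -rowE => h; have /rowP/(_ j) : delta_mx 0 j = 0 :> 'rV[R]_d.
    by apply: h; apply/rowP => i; rewrite 4!mxE (negbTE vTj) mxE.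
  by rewrite !mxE !eqxx => /eqP; rewrite oner_eq0.
have ZH : colsub T Z = colsub T H.
  by apply/matrixP => i j; rewrite [LHS]mxE [RHS]mxE [LHS]mxE vT eqxx.
exists T; pose K := kermx (colsub T H).
have rK : \rank K = 1%N by rewrite mxrank_ker -ZH rT subSnn.
have K0 : K != 0 by rewrite -mxrank_eq0 rK.
have rK1 : \rank (nz_row K) = 1%N by rewrite rank_rV nz_row_eq0 K0.
apply/sub_rVP; apply: submx_trans (_ : v <= K)%MS _.
  apply/sub_kermxP/rowP => j; rewrite [RHS]mxE -[RHS](vT j) [LHS]mxE [RHS]mxE.
  by apply: eq_bigr => i _; rewrite mxE.
by rewrite -(geq_leqif (mxrank_leqif_sup (nz_row_sub K))) rK rK1.
Qed.

(** Description of d+1 rays, each by d functionals and a sign -1, 0 or 1, encoded by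
0, 1 or 2. The sign 0 stands for the zero vector, so that a combination of fewer
than d+1 rays also has a code. *)
Definition cell_code (m : nat) : finType :=
  {ffun 'I_d.+1 -> {ffun 'I_d -> 'I_m} * 'I_3}.

Definition cell_vertex m (H : 'M[R]_(d.+1, m)) (c : cell_code m) (j : 'I_d.+1) :
    'rV[R]_d.+1 :=
  ((c j).2%:R - 1) *: ray (colsub (c j).1 H).

(** The coefficients are strictly positive, so that a functional of constant weak sign
on V can vanish at x only if it vanishes on all of V. *)
Definition in_cell (V : 'I_d.+1 -> 'rV[R]_d.+1) (x : 'rV[R]_d.+1) : Prop :=
  exists2 a : 'I_d.+1 -> R, forall j, 0 < a j & x = \sum_j a j *: V j.

(** A functional that vanishes at some of the vertices and has a constant sign at the
others does not cross: the functionals that define the vertices are of this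
kind. *)
Definition crosses (V : 'I_d.+1 -> 'rV[R]_d.+1) (g : 'cV[R]_d.+1) : bool :=
  [exists j, exists j', (V j *m g) 0 0 * (V j' *m g) 0 0 < 0].

Lemma eq_crosses V V' g : V =1 V' -> crosses V g = crosses V' g.
Proof. by move=> VV'; do 2 apply: eq_existsb => ?; rewrite !VV'. Qed.

Lemma signed_multiple (v r : 'rV[R]_d.+1) (a : R) : v = a *: r ->
  exists (s : 'I_3) (b : R), 0 < b /\ v = b *: ((s%:R - 1) *: r).
Proof.
move=> ->; have [a0|a0|->] := ltgtP a 0.
- exists (inord 0), (- a); rewrite oppr_gt0 inordK // scalerA; split=> //.
  by congr (_ *: _); ring.
- exists (inord 2), a; rewrite inordK // scalerA; split=> //.
  by congr (_ *: _); ring.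
- exists (inord 1), 1; rewrite inordK // scalerA; split=> //.
  by congr (_ *: _); ring.
Qed.

(** The vertices lie in the closure of the cell of x, so no functional of the
arrangement separates two of them. *)
Lemma exists_uncrossed_cell m (H : 'M[R]_(d.+1, m)) (x : 'rV[R]_d.+1) :
  row_free H -> (0 < m)%N ->
  exists c : cell_code m, in_cell (cell_vertex H c) x /\
    forall l, ~~ crosses (cell_vertex H c) (col l H).
Proof.
move=> Hfree m0; have [vs [svs xvs Hvs]] := extremal_ray_decomposition Hfree x.
have {}svs : (size vs <= d.+1)%N := leq_trans svs (rank_leq_row _).
(* Beyond the end of vs the default value 0 is coded with the sign 0; the
coefficient there is any positive number. *)
have key (j : 'I_d.+1) : exists cd : ({ffun 'I_d -> 'I_m} * 'I_3) * R,
    0 < cd.2 /\ nth 0 vs j = cd.2 *: ((cd.1.2%:R - 1) *: ray (colsub cd.1.1 H)).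
  have [jvs|vsj] := ltnP j (size vs); last first.
    pose T := [ffun _ : 'I_d => Ordinal m0].
    have [s [b [b0 e]]] := @signed_multiple 0 (ray (colsub T H)) 0 (esym (scale0r _)).
    by exists ((T, s), b); rewrite nth_default.
  have [v0 _ rv] := Hvs _ (mem_nth 0 jvs).
  have [T [a /signed_multiple [s [b [b0 e]]]]] := extremal_ray_multiple v0 rv.
  by exists ((T, s), b).
have [cd Hcd] := fin_all_exists key.
exists [ffun j => (cd j).1].
have vE j : cell_vertex H [ffun j => (cd j).1] j = (cd j).2^-1 *: nth 0 vs j.
  rewrite /cell_vertex ffunE (Hcd j).2 scalerA mulVf ?scale1r //.
  by rewrite gt_eqF ?(Hcd j).1.
split.
  exists (fun j => (cd j).2) => [j|]; first exact: (Hcd j).1.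
  rewrite xvs (big_nth 0) big_mkord (big_ord_widen_cond _ predT _ svs).
  rewrite [RHS](bigID (fun j : 'I_d.+1 => (j < size vs)%N)) /= [X in _ + X]big1.
    rewrite addr0; apply: eq_bigr => j _.
    by rewrite vE scalerA mulfV ?scale1r // gt_eqF ?(Hcd j).1.
  by move=> j; rewrite -leqNgt => h; rewrite vE nth_default // !scaler0.
move=> l; apply/existsPn => j; apply/existsPn => j'; rewrite -leNgt !vE.
have value (w : 'rV_d.+1) b : ((b *: w) *m col l H) 0 0 = b * (w *m H) 0 l.
  rewrite -scalemxAl [LHS]mxE; congr (_ * _); rewrite [LHS]mxE [RHS]mxE.
  by apply: eq_bigr => i _; rewrite mxE.
have sgn (i : 'I_d.+1) : ((x *m H) 0 l = 0 -> (nth 0 vs i *m H) 0 l = 0) /\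
    0 <= (x *m H) 0 l * (nth 0 vs i *m H) 0 l.
  have [ivs|vsi] := ltnP i (size vs); last first.
    have h0 : ((0 : 'rV_d.+1) *m H) 0 l = 0 by rewrite mul0mx mxE.
    by rewrite nth_default // h0 mulr0.
  by have [_ [/sub_faceP h1 h2] _] := Hvs _ (mem_nth 0 ivs); split; [exact: h1|].
rewrite !value mulrACA pmulr_rge0; last first.
  by rewrite mulr_gt0 ?invr_gt0 ?(Hcd _).1.
have [x0|x0] := eqVneq ((x *m H) 0 l) 0; first by rewrite (sgn j).1 ?mul0r.
(* Both values have the weak sign of the value at x, which is not 0. *)
rewrite -(@pmulr_rge0 _ (((x *m H) 0 l) ^+ 2)) ?exprn_even_gt0 //.
by rewrite expr2 mulrACA mulr_ge0 ?(sgn _).2.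
Qed.
End Cells.

(** * Random samples *)

Section Sampling.
Local Open Scope nat_scope.

(** In terms of a uniform random sample S of size s: condition on the values of S in
the positions of A. They determine X S, and if X S has proportion more than 1/M,
each of the other s - |A| independent values avoids it with probability less than
1 - 1/M. So the probability that X S is heavy and avoided is at most 2^(-t). *)
Lemma avoiding_samples_bound (J : finType) (j0 : J) (s M t : nat) (A : {set 'I_s})
    (X : {ffun 'I_s -> J} -> {set J}) :
  0 < M -> (forall S S' : {ffun 'I_s -> J}, {in A, S =1 S'} -> X S = X S') ->
  M.-1 ^ (s - #|A|) * 2 ^ t <= M ^ (s - #|A|) ->
  #|[set S : {ffun 'I_s -> J} |
      [forall (l | l \notin A), S l \notin X S] && (#|J| < #|X S| * M)]| * 2 ^ t
    <= #|J| ^ s.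
Proof.
move=> M0 XA HM; set bad := [set S | _].
(* S restricted to A, with a default value elsewhere, to sum over the fibers. *)
pose u (S : {ffun 'I_s -> J}) := [ffun l => if l \in A then S l else j0].
set e := s - #|A| in HM *.
have leAs : #|A| <= s by rewrite -[X in _ <= X]card_ord max_card.
have uP (S : {ffun 'I_s -> J}) : S \in bad -> u S \in pffun_on j0 (mem A) predT.
  move=> _; apply/pffun_onP; split=> //.
  by apply/supportP => l lA; rewrite ffunE (negbTE lA).
have fiber w : w \in pffun_on j0 (mem A) predT ->
    (\sum_(S in bad | u S == w) 1) * 2 ^ t <= #|J| ^ e.
  move=> _; have [hw|hw] := boolP (#|J| < #|X w| * M); last first.
    rewrite big1 // => S; rewrite inE => /andP[/andP[_ hS] /eqP uS].
    suff XS : X S = X w by rewrite -XS hS in hw.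
    by apply: XA => l lA; rewrite -uS ffunE lA.
  pose F (l : 'I_s) : pred J := if l \in A then pred1 (w l) else [predC X w].
  have cF : #|(family F : simpl_pred {ffun 'I_s -> J})| = (#|J| - #|X w|) ^ e.
    rewrite card_family foldrE big_map big_enum /= (bigID (mem A)) /=.
    rewrite big1 => [|l lA]; last by rewrite /F lA card1.
    rewrite mul1n (eq_bigr (fun=> #|J| - #|X w|)) => [|l lA]; last first.
      by rewrite /F (negbTE lA) -(cardC (mem (X w))) addKn.
    rewrite prod_nat_const; congr (_ ^ _).
    by apply/eqP; rewrite -(eqn_add2l #|A|) subnKC ?leAs // -[X in _ == X]card_ord cardC.
  have le1 : \sum_(S in bad | u S == w) 1 <= (#|J| - #|X w|) ^ e.
    rewrite -cF sum1_card; apply: subset_leq_card; apply/subsetP => S.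
    rewrite unfold_in /= inE => /andP[/andP[/forall_inP hS _] /eqP uS].
    have XS : X S = X w by apply: XA => l lA; rewrite -uS ffunE lA.
    apply/familyP => l; rewrite /F; case: ifP => lA.
      by rewrite -uS unfold_in /= ffunE lA.
    by rewrite inE /= -XS hS // lA.
  have Y : (#|J| - #|X w|) * M <= #|J| * M.-1.
    by rewrite mulnBl -subn1 mulnBr muln1 leq_sub2l // ltnW.
  apply: leq_trans (leq_mul le1 (leqnn _)) _.
  rewrite -(@leq_pmul2r (M ^ e)) ?expn_gt0 ?M0 // mulnAC -expnMn.
  apply: leq_trans (_ : (#|J| * M.-1) ^ e * 2 ^ t <= _).
    by rewrite leq_mul2r; case: (e) => [|e']; rewrite ?leqnn ?leq_exp2r ?Y ?orbT.
  by rewrite expnMn -mulnA leq_mul2l HM orbT.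
rewrite -sum1_card (partition_big u _ uP) /= big_distrl /=.
apply: leq_trans (_ : \sum_(w in pffun_on j0 (mem A) predT) #|J| ^ e <= _).
  by apply: leq_sum => w /fiber; congr (_ <= _); congr (_ * _); apply: eq_bigl.
by rewrite sum_nat_const card_pffun_on -expnD subnKC.
Qed.

End Sampling.

(** * Cuttings for families of linear functionals *)

Section SamplingCells.
Context {R : realFieldType} {d : nat} {J : finType} (g : J -> 'cV[R]_d.+1).
Context {s : nat}.
Implicit Types S : {ffun 'I_s -> J}.

(** The coordinate functionals are added to the sample to make the arrangement
pointed. *)
Definition sample_mx S : 'M[R]_(d.+1, s + d.+1) :=
  row_mx (\matrix_(i, l) g (S l) i 0) 1%:M.

Definition sample_cell S (c : cell_code (s + d.+1)) := cell_vertex (sample_mx S) c.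

Lemma sample_mx_free S : row_free (sample_mx S).
Proof.
by apply/row_freeP; exists (col_mx 0 1%:M); rewrite mul_row_col mulmx0 add0r mulmx1.
Qed.

Lemma col_sample_mx S l : col (lshift d.+1 l) (sample_mx S) = g (S l).
Proof. by apply/colP => i; rewrite mxE row_mxEl mxE. Qed.

(** The members of the sample that occur in the description; the coordinate
functionals do not count, since they are the same for all samples. *)
Definition used_positions (c : @cell_code d (s + d.+1)) : {set 'I_s} :=
  [set l | [exists j, exists b, (c j).1 b == lshift d.+1 l]].

Lemma card_used_positions c : (#|used_positions c| <= d.+1 * d)%N.
Proof.
have linj : injective (@lshift s d.+1) := @lshift_inj _ _.
rewrite -(card_imset _ linj).
apply: leq_trans (_ : #|[set (c jb.1).1 jb.2 | jb : 'I_d.+1 * 'I_d]| <= _)%N.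
  apply/subset_leq_card/subsetP => _ /imsetP[l + ->].
  by rewrite inE => /existsP[j /existsP[b /eqP <-]]; apply/imsetP; exists (j, b).
by apply: leq_trans (leq_imset_card _ _) _; rewrite card_prod !card_ord.
Qed.

Lemma sample_cell_local S S' c : {in used_positions c, S =1 S'} ->
  sample_cell S c =1 sample_cell S' c.
Proof.
move=> SS' j; rewrite /sample_cell /cell_vertex; congr (_ *: ray _).
apply/matrixP => i b; rewrite !mxE.
case: (split_ordP ((c j).1 b)) => l e; rewrite ?e ?row_mxEl ?row_mxEr // !mxE SS' //.
by rewrite inE; apply/existsP; exists j; apply/existsP; exists b; rewrite e.
Qed.

Definition crossing_set S c : {set J} := [set j | crosses (sample_cell S c) (g j)].

(** Union bound: there are fewer than 2^t codes, and for each of them a sample for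
which the cell is crossed too often and yet is crossed by no member of the sample
has probability at most 2^(-t), because the cell depends on few members of the
sample. *)
Lemma exists_cutting_sample (j0 : J) (M t : nat) : (0 < M)%N ->
  (forall e, s - d.+1 * d <= e -> M.-1 ^ e * 2 ^ t <= M ^ e)%N ->
  (#|{: @cell_code d (s + d.+1)}| < 2 ^ t)%N ->
  exists S, forall c, (forall l, ~~ crosses (sample_cell S c) (g (S l))) ->
    (#|crossing_set S c| * M <= #|J|)%N.
Proof.
move=> M0 HM Hr.
pose bad c := [set S : {ffun 'I_s -> J} |
  [forall (l | l \notin used_positions c), S l \notin crossing_set S c] &&
  (#|J| < #|crossing_set S c| * M)%N].
have badc c : (#|bad c| * 2 ^ t <= #|J| ^ s)%N.
  apply: (avoiding_samples_bound j0 (A := used_positions c)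
    (X := crossing_set^~ c) M0) => [S S' SS'|].
    apply/setP => j; rewrite [LHS]in_set [RHS]in_set.
    by apply: eq_crosses; exact: sample_cell_local.
  by apply: HM; rewrite leq_sub2l // card_used_positions.
have big_bad : (#|\bigcup_c bad c| < #|J| ^ s)%N.
  apply: leq_ltn_trans (_ : \sum_c #|bad c| < _)%N.
    elim/big_rec2: _ => [|c x y _ xy]; first by rewrite cards0.
    by apply: leq_trans (leq_card_setU _ _) _; rewrite leq_add2l.
  rewrite -(@ltn_pmul2r (2 ^ t)) ?expn_gt0 // big_distrl /=.
  apply: (@leq_ltn_trans (\sum_(c : @cell_code d (s + d.+1)) #|J| ^ s)).
    by apply: leq_sum => c _; exact: badc.
  rewrite sum_nat_const mulnC ltn_pmul2l; first exact: Hr; rewrite expn_gt0; apply/orP; left.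
  by apply/card_gt0P; exists j0.
have [S Sbad] : exists S, S \notin \bigcup_c bad c.
  apply/existsP; apply: contraTT big_bad => /existsPn h.
  rewrite -leqNgt -[s in X in (X <= _)%N]card_ord -card_ffun.
  by apply/subset_leq_card/subsetP => S _; have := h S; rewrite negbK.
exists S => c hc; rewrite leqNgt; apply: contra Sbad => lt.
apply/bigcupP; exists c => //; rewrite inE lt andbT.
by apply/forall_inP => l _; rewrite inE.
Qed.
End SamplingCells.

(** * Counting transversals *)

Section Transversals.
Context {T : finType} {k : nat}.
Implicit Types (Q : 'I_k -> {set T}) (p : {ffun 'I_k -> T}).

Definition transversals Q : {set {ffun 'I_k -> T}} :=
  [set p : {ffun 'I_k -> T} | [forall j, p j \in Q j]].

Definition replace_at {A : Type} (Q : 'I_k -> A) (i : 'I_k) (X : A) : 'I_k -> A :=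
  fun j => if j == i then X else Q j.

Lemma transversalsP Q p : reflect (forall j, p j \in Q j) (p \in transversals Q).
Proof. by rewrite inE; exact: forallP. Qed.

(** This involution stands for the independence of the i-th point of a random
transversal from the other ones. *)
Definition swap_at i (px : {ffun 'I_k -> T} * T) : {ffun 'I_k -> T} * T :=
  ([ffun j => replace_at px.1 i px.2 j], px.1 i).

Lemma swap_atK i : involutive (swap_at i).
Proof.
case=> p x; rewrite /swap_at /replace_at /= ffunE eqxx; congr (_, _).
by apply/ffunP => j; rewrite !ffunE; case: eqP => [->|].
Qed.

(** A condition that does not depend on the i-th point has the same probability when
the i-th set is restricted. *)
Lemma card_transversals_restrict Q i (X : {set T}) (E : pred {ffun 'I_k -> T}) :
  X \subset Q i -> (forall p x, E [ffun j => replace_at p i x j] = E p) ->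
  (#|[set p in transversals (replace_at Q i X) | E p]| * #|Q i| =
   #|[set p in transversals Q | E p]| * #|X|)%N.
Proof.
move=> XQ Ei; rewrite -!cardsX.
rewrite -[in RHS](card_imset _ (inv_inj (swap_atK i))).
rewrite (can2_imset_pre _ (swap_atK i) (swap_atK i)); congr #|pred_of_set _|.
apply/setP=> -[p x]; rewrite !inE /= Ei [in RHS]andbAC [in LHS]andbAC; congr (_ && _).
apply/andP/andP => -[/forallP h1 h2]; split.
- apply/forallP => j; rewrite ffunE; have := h1 j; rewrite /replace_at.
  by case: eqP => // ->.
- by have := h1 i; rewrite /replace_at eqxx.
- apply/forallP => j; have := h1 j; rewrite ffunE /replace_at.
  by case: eqP => // ->.
- by have := h1 i; rewrite ffunE /replace_at eqxx.
Qed.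

Lemma card_transversals_replace Q i (X : {set T}) : X \subset Q i ->
  (#|transversals (replace_at Q i X)| * #|Q i| = #|transversals Q| * #|X|)%N.
Proof.
move=> XQ; have := @card_transversals_restrict Q i X xpredT XQ (fun _ _ => erefl).
by congr (_ * _ = _ * _)%N; congr #|pred_of_set _|; apply/setP => p; rewrite inE andbT.
Qed.

Lemma transversals_gt0 Q : (forall j, Q j != set0) -> (0 < #|transversals Q|)%N.
Proof.
move=> Q0; have ex j : exists x, x \in Q j by apply/set0Pn.
have [p hp] := fin_all_exists ex; apply/card_gt0P; exists (finfun p).
by apply/transversalsP => j; rewrite ffunE.
Qed.

Lemma leq_sum_exists (I : finType) (F G : I -> nat) : (0 < #|I|)%N ->
  (\sum_c F c <= \sum_c G c)%N -> exists c, (F c <= G c)%N.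
Proof.
move=> I0 FG; apply/existsP; apply: contraTT FG => /existsPn h.
rewrite -ltnNge; apply: (@leq_trans (\sum_c (G c).+1)).
  under [X in (_ < X)%N]eq_bigr do rewrite -addn1.
  by rewrite big_split /= sum1_card -addn1 leq_add2l.
by apply: leq_sum => c _; rewrite ltnNge h.
Qed.

(** On average over the parts, weighted by their sizes, the proportion of bad
transversals does not change. The average is taken with a penalty for small parts:
comparing b_c + delta N / (E |C|) with 2 delta N |X_c| / (E |Q_i|), where b_c counts
the bad transversals through the part X_c and N counts all transversals, gives a
single part that is both large and not worse than twice the bound delta / E. *)
Lemma exists_large_quiet_part (C : finType) (Q : 'I_k -> {set T}) (i : 'I_k)
    (cell : T -> C) (bad : pred {ffun 'I_k -> T}) (delta E : nat) :
  (0 < delta)%N -> (forall j, Q j != set0) ->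
  (#|[set p in transversals Q | bad p]| * E <= delta * #|transversals Q|)%N ->
  exists c, let X := [set x in Q i | cell x == c] in
    (#|Q i| <= 2 * #|C| * #|X|)%N /\
    (#|[set p in transversals (replace_at Q i X) | bad p]| * E
       <= 2 * delta * #|transversals (replace_at Q i X)|)%N.
Proof.
move=> d0 Q0 Hbad; pose X c := [set x in Q i | cell x == c].
have XQ c : X c \subset Q i by apply/subsetP => x; rewrite inE => /andP[].
pose N := #|transversals Q|; pose q := #|Q i|.
pose b c := #|[set p in transversals (replace_at Q i (X c)) | bad p]|.
have N0 : (0 < N)%N by exact: transversals_gt0.
have q0 : (0 < q)%N by rewrite card_gt0.
have C0 : (0 < #|C|)%N.
  by have /set0Pn[x _] := Q0 i; apply/card_gt0P; exists (cell x).
have sumX : (\sum_c #|X c| = q)%N.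
  rewrite /q -sum1_card (partition_big cell predT) //=.
  by apply: eq_bigr => c _; rewrite -sum1_card; apply: eq_bigl => x; rewrite inE.
have sumb : (\sum_c b c = #|[set p in transversals Q | bad p]|)%N.
  rewrite -[RHS]sum1_card (partition_big (fun p : {ffun 'I_k -> T} => cell (p i)) predT) //=.
  apply: eq_bigr => c _; rewrite /b -sum1_card; apply: eq_bigl => p.
  rewrite !inE andbAC; congr (_ && _); apply/forallP/andP => [h|[/forallP h pc] j].
    split; last by have := h i; rewrite /replace_at eqxx inE => /andP[].
    apply/forallP => j; have := h j; rewrite /replace_at.
    by case: eqP => // -> /(subsetP (XQ c)).
  by rewrite /replace_at; case: eqP => // ->; rewrite inE h.
have [|c Hc] := @leq_sum_exists C
    (fun c => #|C| * q * E * b c + delta * N * q)%N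
    (fun c => 2 * delta * N * #|C| * #|X c|)%N C0.
  rewrite big_split /= -!big_distrr /= sumX sumb sum_nat_const.
  move: Hbad; rewrite -/N; set B := #|[set _ in _ | _]| => Hbad.
  have -> : #|(fun=> true) : pred C| = #|C| by apply: eq_card.
  have := leq_mul (leqnn (#|C| * q)%N) Hbad; nia.
exists c; rewrite /= -/(X c); split.
  have : (delta * N * q <= delta * N * (2 * #|C| * #|X c|))%N by nia.
  by rewrite leq_pmul2l ?muln_gt0 ?d0.
have e := card_transversals_replace (XQ c).
pose Nc := #|transversals (replace_at Q i (X c))|.
have : (#|C| * q * (b c * E) <= #|C| * q * (2 * delta * Nc))%N.
  have -> : (#|C| * q * (2 * delta * Nc) = 2 * delta * #|C| * (Nc * #|Q i|))%N.
    by rewrite /q; nia.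
  rewrite e -/N; apply: leq_trans (_ : (#|C| * q * E * b c + delta * N * q <= _)%N); first nia.
  by apply: leq_trans Hc _; nia.
by rewrite leq_pmul2l ?muln_gt0 ?C0.
Qed.

End Transversals.

(** * Orientations of partially replaced transversals *)

Section RowReplacement.
Context {R : realFieldType} {n : nat}.
Implicit Types (A : 'M[R]_n) (a : 'I_n) (x : 'rV[R]_n).

Definition replace_row A a x : 'M[R]_n := \matrix_b (if b == a then x else row b A).

Definition cofactor_col A a : 'cV[R]_n := \col_b cofactor A a b.

Lemma det_replace_row A a x : \det (replace_row A a x) = (x *m cofactor_col A a) 0 0.
Proof.
rewrite (expand_det_row _ a) [RHS]mxE; apply: eq_bigr => b _.
rewrite [replace_row _ _ _ _ _]mxE eqxx [cofactor_col _ _ _ _]mxE; congr (_ * _).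
rewrite /cofactor; congr (_ * \det _); apply/matrixP => i j.
by rewrite ![row' _ _ _ _]mxE ![col' _ _ _ _]mxE [LHS]mxE eq_sym (negbTE (neq_lift _ _)) mxE.
Qed.

Lemma eq_cofactor_col A B a : (forall b, b != a -> row b A = row b B) ->
  cofactor_col A a = cofactor_col B a.
Proof.
move=> AB; apply/colP => b; rewrite !mxE /cofactor; congr (_ * \det _).
apply/matrixP => i j; rewrite !mxE.
have /AB/rowP/(_ (lift b j)) : lift a i != a by rewrite eq_sym neq_lift.
by rewrite !mxE.
Qed.

Lemma replace_row_id A a : replace_row A a (row a A) = A.
Proof. by apply/row_matrixP => b; rewrite rowK; case: eqP => // ->. Qed.

End RowReplacement.

Section Step.
Context {R : realFieldType} {d k : nat} {T : finType} (pt : T -> 'rV[R]_d.+1).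
Local Notation vertices := ('I_k -> 'I_d.+1 -> 'rV[R]_d.+1).
Local Notation choice_of_points := {ffun 'I_k -> T}.
Local Notation choice_of_sets := {ffun 'I_d.+1 -> 'I_k}.
Local Notation choice_of_vertices := {ffun 'I_d.+1 -> 'I_d.+1}.
Implicit Types (V : vertices) (p : choice_of_points) (f : choice_of_sets).
Implicit Types (u : choice_of_vertices) (i : nat).

Definition mixed_mx i V p f u : 'M[R]_d.+1 :=
  \matrix_a (if (f a < i)%N then V (f a) (u a) else pt (p (f a))).

Definition weakly_oriented i V p f : bool :=
  [exists b : bool, [forall u : choice_of_vertices,
    0 <= (-1) ^+ b * \det (mixed_mx i V p f u)]].

Definition weakly_typed i V p : bool :=
  [forall f : choice_of_sets, injectiveb f ==> weakly_oriented i V p f].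

(** The transversals for which replacing the i-th set by W may leave the sign of some
orientation undetermined. The i-th point of p does not matter
([spoiled_indep]), since it is the argument of the functionals. *)
Definition spoiled (i : 'I_k) V (W : 'I_d.+1 -> 'rV[R]_d.+1) p : bool :=
  [exists f : choice_of_sets, exists a, exists u : choice_of_vertices,
    [&& injectiveb f, f a == i & crosses W (cofactor_col (mixed_mx i V p f u) a)]].

Lemma spoiled_indep (i : 'I_k) V W p x :
  spoiled i V W [ffun j => replace_at p i x j] = spoiled i V W p.
Proof.
apply: eq_existsb => f; apply: eq_existsb => a; apply: eq_existsb => u.
have [inj|//] := boolP (injectiveb f); have [fa|//] := eqVneq (f a) i; rewrite /=.
congr crosses; apply: eq_cofactor_col => b ba; rewrite !rowK.
case: ifP => // _; rewrite ffunE /replace_at -fa.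
by rewrite (inj_eq (injectiveP _ inj)) (negbTE ba).
Qed.

(** Consider the orientation as a functional of the i-th point. On W it has constant
weak sign, and its value at the i-th point of p, which is a strictly positive
combination of W, has the old sign sg. If the constant sign on W were opposite to
sg with a nonzero value somewhere, the value at the point would be of strict sign
opposite to sg. *)
Lemma weakly_typed_step (i : 'I_k) V W p : in_cell W (pt (p i)) ->
  weakly_typed i V p -> ~~ spoiled i V W p -> weakly_typed i.+1 (replace_at V i W) p.
Proof.
move=> [c c0 pi] /forallP gp Ncr; apply/forallP => f; apply/implyP => inj.
have := gp f; rewrite inj /= => /existsP[b /forallP hb].
apply/existsP; exists b; apply/forallP => u.
have [/existsP[a /eqP fa]|/existsPn nfa] := boolP [exists a, f a == i]; last first.
  suff -> : mixed_mx i.+1 (replace_at V i W) p f u = mixed_mx i V p f u by [].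
  apply/row_matrixP => a; rewrite !rowK /replace_at (negbTE (nfa a)).
  by rewrite ltnS leq_eqVlt val_eqE (negbTE (nfa a)).
set A := mixed_mx i V p f u.
have -> : mixed_mx i.+1 (replace_at V i W) p f u = replace_row A a (W (u a)).
  apply/row_matrixP => b'; rewrite !rowK /replace_at -fa.
  rewrite (inj_eq (injectiveP _ inj)); case: eqP => [->|/eqP b'a].
    by rewrite ltnSn.
  rewrite ltnS leq_eqVlt val_eqE.
  by rewrite (inj_eq (injectiveP _ inj)) (negbTE b'a).
have noX j j' : 0 <= (W j *m cofactor_col A a) 0 0 * (W j' *m cofactor_col A a) 0 0.
  rewrite leNgt; apply: contra Ncr => h.
  apply/existsP; exists f; apply/existsP; exists a; apply/existsP; exists u.
  by rewrite inj fa eqxx /=; apply/existsP; exists j; apply/existsP; exists j'.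
have := hb u; rewrite -/A -{1}(replace_row_id A a) !det_replace_row rowK fa ltnn pi.
rewrite mulmx_suml summxE.
set g := cofactor_col A a in noX *; set sg := (-1) ^+ b.
move=> hsum; rewrite leNgt; apply/negP => neg.
move: hsum; rewrite leNgt => /negP; apply.
rewrite mulr_sumr (bigD1 (u a)) //= -scalemxAl mxE.
rewrite -[X in _ < X]addr0 ltr_leD //; first by rewrite mulrCA pmulr_rlt0.
apply: sumr_le0 => j _; rewrite -scalemxAl mxE mulrCA pmulr_rle0 //.
have := noX (u a) j.
have -> (y z : R) : y * z = (sg * y) * (sg * z).
  by rewrite mulrACA -expr2 /sg sqrr_sign mul1r.
by rewrite nmulr_rge0.
Qed.

Lemma weakly_typed0 V p : weakly_typed 0 V p.
Proof.
apply/forallP => f; apply/implyP => _.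
pose A : 'M_d.+1 := \matrix_a pt (p (f a)).
have e u : mixed_mx 0 V p f u = A by apply/row_matrixP => a; rewrite !rowK.
have [h|h] := leP 0 (\det A).
  by apply/existsP; exists false; apply/forallP => u; rewrite e mul1r.
by apply/existsP; exists true; apply/forallP => u; rewrite e expr1 mulN1r oppr_ge0 ltW.
Qed.

End Step.

(** * Weak order types on the selected subsets *)

Section Orientation.
Context {R : realFieldType} {d : nat}.

(** Multilinearity: replace the vertices by points of the cones one row at a time. *)
Lemma det_cells_ge0 (W : 'I_d.+1 -> 'I_d.+1 -> 'rV[R]_d.+1) (sg : R)
    (x : 'I_d.+1 -> 'rV[R]_d.+1) :
  (forall u : {ffun 'I_d.+1 -> 'I_d.+1}, 0 <= sg * \det (\matrix_a W a (u a))) ->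
  (forall a, in_cell (W a) (x a)) -> 0 <= sg * \det (\matrix_a x a).
Proof.
move=> HW Hx.
suff H m (y : 'I_d.+1 -> 'rV[R]_d.+1) : (m <= d.+1)%N ->
    (forall a : 'I_d.+1, if (a < m)%N then in_cell (W a) (y a) else exists j, y a = W a j) ->
    0 <= sg * \det (\matrix_a y a).
  by apply: (H d.+1) => // a; rewrite ltn_ord.
elim: m y => [|m IH] y md Hy.
  have [u hu] := fin_all_exists Hy.
  have -> : \matrix_a y a = \matrix_a W a (finfun u a).
    by apply/row_matrixP => a; rewrite !rowK ffunE hu.
  exact: HW.
pose a0 := Ordinal md; pose A := \matrix_a y a.
have := Hy a0; rewrite ltnSn => -[c c0 ya0].
rewrite -/A -(replace_row_id A a0) det_replace_row rowK ya0 mulmx_suml summxE mulr_sumr.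
apply: sumr_ge0 => j _; rewrite -scalemxAl mxE mulrCA mulr_ge0 ?(ltW (c0 j)) //.
rewrite -det_replace_row.
have -> : replace_row A a0 (W a0 j) = \matrix_a (if a == a0 then W a0 j else y a).
  by apply/row_matrixP => a; rewrite !rowK.
apply: IH => [|a]; first exact: ltnW.
have [->|aa0] := eqVneq a a0; first by rewrite ltnn; exists j.
have := Hy a; rewrite ltnS leq_eqVlt.
by rewrite -[_ == m]/(val a == val a0) val_eqE (negbTE aa0).
Qed.

End Orientation.

Lemma scale_count (a a' b b' x q E : nat) : (0 < q)%N -> (a * E <= b)%N ->
  (b' * q = b * x)%N -> (a' * q = a * x)%N -> (a' * E <= b')%N.
Proof.
move=> q0 ab eb ea; rewrite -(leq_pmul2r q0) mulnAC ea eb mulnAC.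
exact: leq_mul.
Qed.

Section Main.
Context {R : realFieldType} {d k : nat} {T : finType} (pt : T -> 'rV[R]_d.+1).
Local Notation vertices := ('I_k -> 'I_d.+1 -> 'rV[R]_d.+1).
Local Notation choice_of_points := {ffun 'I_k -> T}.
Local Notation choice_of_sets := {ffun 'I_d.+1 -> 'I_k}.
Local Notation choice_of_vertices := {ffun 'I_d.+1 -> 'I_d.+1}.

Context {s M t E : nat}.
Hypothesis M_gt0 : (0 < M)%N.
Hypothesis hitting :
  (forall e, s - d.+1 * d <= e -> M.-1 ^ e * 2 ^ t <= M ^ e)%N.
Hypothesis few_cells : (#|{: @cell_code d (s + d.+1)}| < 2 ^ t)%N.
Hypothesis sample_fine : (E * (k ^ d.+1 * d.+1 ^ d.+1 * d.+1) <= M)%N.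

(** Cutting for the uniform family of all functionals given by a transversal, a tuple
f of sets, a choice of vertices and a row. Per transversal there are
k^(d+1) (d+1)^(d+1) (d+1) of them, so the proportion of transversals spoiled by a
cell is at most that factor times the proportion of functionals crossing it. *)
Lemma exists_unspoiled_cells (i : 'I_k) (V : vertices) (Q : 'I_k -> {set T}) :
  (forall j, Q j != set0) ->
  exists (cell : T -> @cell_code d (s + d.+1))
         (W : @cell_code d (s + d.+1) -> 'I_d.+1 -> 'rV[R]_d.+1),
  forall x, in_cell (W (cell x)) (pt x) /\
    (#|[set p in transversals Q | spoiled pt i V (W (cell x)) p]| * E
       <= #|transversals Q|)%N.
Proof.
move=> Q0; pose J := ({p | p \in transversals Q} * choice_of_sets *
  choice_of_vertices * 'I_d.+1)%type.
pose g (z : J) : 'cV[R]_d.+1 :=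
  cofactor_col (mixed_mx pt i V (val z.1.1.1) z.1.1.2 z.1.2) z.2.
have cJ : #|{: J}| = (#|transversals Q| * (k ^ d.+1 * d.+1 ^ d.+1 * d.+1))%N.
  rewrite !card_prod card_sig !card_ffun !card_ord !mulnA.
  by congr (_ * _ * _ * _)%N; apply: eq_card.
have /card_gt0P[p0 hp0] := transversals_gt0 Q0.
pose z0 : J := (exist _ p0 hp0, [ffun=> i], [ffun=> ord0], ord0).
have [S HS] := exists_cutting_sample g z0 M_gt0 hitting few_cells.
have Hcell x := @exists_uncrossed_cell _ _ _ _ (pt x) (sample_mx_free g S)
  (ltn_addl s (ltn0Sn d)).
have [cell cellP] := fin_all_exists Hcell.
exists cell, (sample_cell g S) => x; split; first exact: (cellP x).1.
have : (#|crossing_set g S (cell x)| * M <= #|{: J}|)%N.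
  by apply: HS => l; rewrite -(col_sample_mx g); exact: (cellP x).2.
rewrite cJ; set F := (k ^ _ * _ * _)%N => Hcross.
have F0 : (0 < F)%N.
  by rewrite /F !muln_gt0 !expn_gt0 /= (leq_ltn_trans (leq0n i) (ltn_ord i)).
have le : (#|[set p in transversals Q | spoiled pt i V (sample_cell g S (cell x)) p]|
    <= #|crossing_set g S (cell x)|)%N.
  apply: leq_trans (leq_imset_card (fun z : J => val z.1.1.1) _).
  apply/subset_leq_card/subsetP => p; rewrite inE => /andP[hp].
  move=> /existsP[f /existsP[a /existsP[u /and3P[_ _ cr]]]].
  by apply/imsetP; exists (exist _ p hp, f, u, a) => //; rewrite inE.
rewrite -(leq_pmul2r F0) -mulnA; apply: leq_trans Hcross.
by apply: leq_mul le _; exact: sample_fine.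
Qed.

(** The bad transversals after the step were bad before it, or are spoiled by the
chosen cell. Spoiling does not depend on the i-th point, so restricting that point
to X does not change its probability. *)
Lemma refine_one_set (i : 'I_k) (V : vertices) (Q : 'I_k -> {set T}) (delta : nat) :
  (0 < delta)%N -> (forall j, Q j != set0) ->
  (#|[set p in transversals Q | ~~ weakly_typed pt i V p]| * E
     <= delta * #|transversals Q|)%N ->
  exists (X : {set T}) (W : 'I_d.+1 -> 'rV[R]_d.+1),
  let Q' := replace_at Q i X in
  [/\ X \subset Q i, (#|Q i| <= 2 ^ t.+1 * #|X|)%N,
      (forall x, x \in X -> in_cell W (pt x)) &
      (#|[set p in transversals Q' | ~~ weakly_typed pt i.+1 (replace_at V i W) p]| * E
         <= (2 * delta).+1 * #|transversals Q'|)%N].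
Proof.
move=> d0 Q0 Hbad.
have [cell [W HW]] := exists_unspoiled_cells i V Q0.
have [c] := exists_large_quiet_part i cell d0 Q0 Hbad.
set X := [set x in Q i | cell x == c]; set Q' := replace_at Q i X => -[HX HX'].
exists X, (W c); split.
- by apply/subsetP => x; rewrite inE => /andP[].
- apply: leq_trans HX _; rewrite leq_mul2r expnS leq_mul2l; apply/orP; right.
  by rewrite ltnW.
- by move=> x; rewrite inE => /andP[_ /eqP <-]; exact: (HW x).1.
have XQ : X \subset Q i by apply/subsetP => x; rewrite inE => /andP[].
have qi0 : (0 < #|Q i|)%N by rewrite card_gt0.
(* Only cells that contain a point are known to be crossed rarely. *)
have [x0] : exists x, x \in X.
  by apply/card_gt0P; move: HX; case: #|X| => // ; rewrite muln0 leqNgt qi0.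
rewrite inE => /andP[_ /eqP cx0].
have spQ := (HW x0).2; rewrite cx0 in spQ.
have spQ' : (#|[set p in transversals Q' | spoiled pt i V (W c) p]| * E
    <= #|transversals Q'|)%N.
  have e2 := card_transversals_replace XQ.
  have e1 := card_transversals_restrict XQ (spoiled_indep pt i V (W c)).
  exact: (scale_count qi0 spQ e2 e1).
have sub : [set p in transversals Q' | ~~ weakly_typed pt i.+1 (replace_at V i (W c)) p]
   \subset
   [set p in transversals Q' | ~~ weakly_typed pt i V p] :|:
   [set p in transversals Q' | spoiled pt i V (W c) p].
  apply/subsetP => p; rewrite !inE => /andP[hp]; rewrite hp /=; apply: contraR.
  rewrite negb_or negbK => /andP[gp sp]; apply: weakly_typed_step => //.
  move: hp => /forallP/(_ i); rewrite /Q' /replace_at eqxx inE => /andP[_ /eqP <-].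
  exact: (HW _).1.
rewrite mulSn addnC; apply: leq_trans (leq_add HX' spQ').
rewrite -mulnDl leq_mul2r (leq_trans (subset_leq_card sub)) ?orbT //.
exact: leq_card_setU.
Qed.

Variable P : 'I_k -> {set T}.
Hypothesis P_neq0 : forall j, P j != set0.

(** The bound on the bad transversals comes from the recursion
delta(i+1) = 2 delta(i) + 1; starting with delta(0) = 1 instead of 0 is needed for
the selection of a large part. *)
Lemma refine_first_sets (i : nat) : (i <= k)%N ->
  exists (Q : 'I_k -> {set T}) (V : vertices),
  [/\ forall j, Q j \subset P j,
      forall j : 'I_k, (i <= j)%N -> Q j = P j,
      forall j, (#|P j| <= 2 ^ t.+1 * #|Q j|)%N,
      forall (j : 'I_k) x, (j < i)%N -> x \in Q j -> in_cell (V j) (pt x) &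
      (#|[set p in transversals Q | ~~ weakly_typed pt i V p]| * E
         <= (2 ^ i.+1).-1 * #|transversals Q|)%N].
Proof.
elim: i => [_|i IH ik].
  exists P, (fun _ _ => 0); split=> // [j|]; first by rewrite leq_pmull ?expn_gt0.
  rewrite (_ : [set _ in _ | _] = set0) ?cards0 ?mul0n //.
  by apply/setP => p; rewrite !inE weakly_typed0 andbF.
have [Q [V [QP Qlater Qbig QV Qbad]]] := IH (ltnW ik).
have Q0 j : Q j != set0.
  rewrite -card_gt0; have := Qbig j; rewrite lt0n; apply: contraTneq => ->.
  by rewrite muln0 -ltnNge card_gt0.
pose i' := Ordinal ik.
have [|X [W [XQ Xbig XW Xbad]]] := @refine_one_set i' V Q (2 ^ i.+1).-1 _ Q0 Qbad.
  by rewrite expnS; have := expn_gt0 2 i; lia.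
exists (replace_at Q i' X), (replace_at V i' W); split.
- move=> j; rewrite /replace_at; case: eqP => [->|_] //.
  exact: subset_trans XQ (QP _).
- move=> j ij; rewrite /replace_at; case: eqP => [e|_]; last exact/Qlater/ltnW.
  by rewrite e ltnn in ij.
- move=> j; rewrite /replace_at; case: eqP => [->|_] //.
  by rewrite -(Qlater i').
- move=> j x; rewrite /replace_at; case: eqVneq => [_ _|ji]; first exact: XW.
  rewrite ltnS leq_eqVlt -[_ == i]/(val j == val i') val_eqE (negbTE ji) /=.
  exact: QV.
- apply: leq_trans Xbad _; rewrite leq_mul2r; apply/orP; right.
  by rewrite (expnS 2 i.+1); have := expn_gt0 2 i.+1; lia.
Qed.

(** At the end the proportion of bad transversals is less than 1, and for a single
transversal to be determined then says that the vertices alone determine all weak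
signs. *)
Lemma weak_same_type : (2 ^ k.+1 <= E)%N ->
  exists Q : 'I_k -> {set T},
  [/\ forall j, Q j \subset P j,
      forall j, (#|P j| <= 2 ^ t.+1 * #|Q j|)%N &
      forall f : choice_of_sets, injective f -> exists b : bool,
        forall q, q \in transversals Q ->
          0 <= (-1) ^+ b * \det (\matrix_a pt (q (f a)))].
Proof.
move=> Ek; have [Q [V [QP _ Qbig QV Qbad]]] := refine_first_sets (leqnn k).
exists Q; split=> // f injf.
have Q0 j : Q j != set0.
  rewrite -card_gt0; have := Qbig j; rewrite lt0n; apply: contraTneq => ->.
  by rewrite muln0 -ltnNge card_gt0.
have N0 := transversals_gt0 Q0.
have [p pQ gp] : exists2 p, p \in transversals Q & weakly_typed pt k V p.
  apply/exists_inP; apply: contraTT Qbad => /exists_inPn h.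
  rewrite (_ : [set _ in _ | _] = transversals Q); last first.
    by apply/setP => p; rewrite inE; case: (boolP (p \in _)) => //= /h.
  rewrite -ltnNge [X in (_ < X)%N]mulnC ltn_pmul2r //; apply: leq_trans Ek.
  by rewrite prednK ?expn_gt0.
move/forallP/(_ f): gp; rewrite (introT (injectiveP _) injf) /=.
case/existsP=> b /forallP hb; exists b => q /transversalsP qQ.
apply: (@det_cells_ge0 _ _ (fun a => V (f a))) => [u|a]; last exact: QV.
have -> : \matrix_a V (f a) (u a) = mixed_mx pt k V p f u.
  by apply/row_matrixP => a; rewrite !rowK ltn_ord.
exact: hb.
Qed.

End Main.

(** * Choice of the parameters *)

Section Numerics.
Local Open Scope nat_scope.

(** The Bernoulli inequality (1 + 1/a)^(a+1) >= 2, for a = M - 1. *)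
Lemma pred_expn_double M : 0 < M -> 2 * M.-1 ^ M <= M ^ M.
Proof.
case: M => // a _; rewrite [_.-1]/=.
have bernoulli e : a ^ e.+1 + e.+1 * a ^ e <= a.+1 ^ e.+1.
  elim: e => [|e IH]; first by rewrite !expn1 expn0 addn1.
  rewrite [X in _ <= X]expnS; apply: leq_trans (leq_mul (leqnn _) IH).
  by rewrite (expnS a e.+1) (expnS a e); nia.
by have := bernoulli a; rewrite [a ^ _]expnS; nia.
Qed.

Lemma pred_expn_small M t e : 0 < M -> M * t <= e -> M.-1 ^ e * 2 ^ t <= M ^ e.
Proof.
move=> M0 te; rewrite -(subnKC te) !expnD mulnAC; apply: leq_mul; last first.
  by case: (e - _) => // e'; rewrite leq_exp2r // leq_pred.
rewrite !expnM -expnMn mulnC; case: t te => // t _.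
by rewrite leq_exp2r // pred_expn_double.
Qed.

Lemma card_cell_code d m : #|{: @cell_code d m}| = (m ^ d * 3) ^ d.+1.
Proof. by rewrite card_ffun card_prod card_ffun !card_ord. Qed.

(** M = 2^m absorbs the factor 2^(k+1) k^(d+1) (d+1)^(d+1) (d+1), and t is an upper
bound for the logarithm of the number of codes for samples of size at most 2^(6m).
The size s = M t + d(d+1) needed for the union bound satisfies this because t is
polynomial in m. *)
Lemma sampling_parameters d k L : 0 < d -> d < k -> 0 < L -> k <= 2 ^ L ->
  exists s M t, [/\ 0 < M,
    forall e, s - d.+1 * d <= e -> M.-1 ^ e * 2 ^ t <= M ^ e,
    #|{: @cell_code d (s + d.+1)}| < 2 ^ t,
    2 ^ k.+1 * (k ^ d.+1 * d.+1 ^ d.+1 * d.+1) <= M &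
    t.+1 <= 66 * d ^ 2 * k * L].
Proof.
move=> d0 dk L0 kL.
pose m := k.+1 + (2 * d.+1 + 1) * L; pose t := (6 * m * d + 2) * d.+1 + 1.
have m8 : 8 <= m by rewrite /m; nia.
have dm : d.+1 < m by rewrite /m; lia.
have mm : m < 2 ^ m by apply: ltn_expl.
exists (2 ^ m * t + d.+1 * d), (2 ^ m), t; split; first by rewrite expn_gt0.
- by move=> e; rewrite addnK => te; apply: pred_expn_small te; rewrite expn_gt0.
- set s := 2 ^ m * t + d.+1 * d; rewrite card_cell_code.
  have s6 : s + d.+1 <= 2 ^ (6 * m).
    have t4 : t <= 2 ^ (4 * m).
      apply: leq_trans (_ : 16 * (m * m * m) <= _).
        rewrite /t; clearbody m; nia.
      have -> : 2 ^ (4 * m) = 2 ^ m * (2 ^ m * 2 ^ m * 2 ^ m).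
        by rewrite -!expnD; congr (2 ^ _); lia.
      apply: leq_mul; last by rewrite !leq_mul // ltnW.
      by apply: leq_trans (_ : 2 ^ 4 <= _) => //; rewrite leq_exp2l //; apply: leq_trans m8.
    have d2 : d.+1 * d + d.+1 <= 2 ^ (4 * m).
      apply: leq_trans t4; rewrite /t; clearbody m; nia.
    rewrite /s -addnA; apply: leq_trans (_ : 2 ^ m * 2 ^ (4 * m) + 2 ^ (4 * m) <= _).
      by apply: leq_add => //; rewrite leq_mul2l t4 orbT.
    have -> : 6 * m = m + 4 * m + m by lia.
    rewrite (expnD 2 (m + 4 * m)) (expnD 2 m); have : 2 <= 2 ^ m by apply: leq_trans mm; lia.
    have : 0 < 2 ^ (4 * m) by rewrite expn_gt0.
    by move: (2 ^ m) (2 ^ (4 * m)) => x y; nia.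
  have : (s + d.+1) ^ d * 3 <= 2 ^ (6 * m * d + 2).
    rewrite expnD (expnM 2 (6 * m)); apply: leq_mul => //.
    by rewrite leq_exp2r.
  rewrite -(@leq_exp2r _ _ d.+1) // -expnM => h; apply: leq_ltn_trans h _.
  by rewrite ltn_exp2l // /t addn1.
- have kd : k ^ d.+1 <= 2 ^ (d.+1 * L) by rewrite mulnC expnM leq_exp2r.
  have -> : 2 ^ m = 2 ^ k.+1 * (2 ^ (d.+1 * L) * 2 ^ (d.+1 * L) * 2 ^ L).
    by rewrite -!expnD; congr (2 ^ _); rewrite /m; lia.
  apply: leq_mul => //; apply: leq_mul; last by apply: leq_trans kL.
  by apply: leq_mul => //; apply: leq_trans kd; rewrite leq_exp2r.
- have m5 : m <= 5 * (k * L) by rewrite /m; nia.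
  rewrite /t -!mulnA; move: (k * L) m5 (leq_mul (leq_ltn_trans (leq0n d) dk) L0) => x m5 x1.
  clearbody m.
  apply: (@leq_trans ((6 * (5 * x * d) + 2) * (2 * d) + 2)); last by nia.
  by rewrite -addn1 -!addnA leq_add2r; apply: leq_mul; nia.
Qed.

End Numerics.

(** * From weak signs to order types *)

Local Open Scope fset_scope.

(** Up to the change of base, up_log 2 k exceeds the logarithm of k by less than 1, so
it is at most twice that logarithm; the exponent 2 of d is then relaxed to 3. *)
Lemma powR_const_bound (R : realType) (d k t : nat) : (0 < d)%N -> (1 < k)%N ->
  (t.+1 <= 66 * d ^ 2 * k * up_log 2 k)%N ->
  2 ^+ t.+1 <= 2 `^ (132 / ln 2 * d%:R ^+ 3 * k%:R * ln k%:R) :> R.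
Proof.
move=> d0 k1 ht; have ln2 : 0 < ln 2 :> R by rewrite ln_gt0 // ltr1n.
rewrite -powR_mulrn // ler_powR ?ler1n //.
set L := up_log 2 k in ht; have L0 : (0 < L)%N by rewrite up_log_gt0.
have lnk2 : ln 2 <= ln k%:R :> R by rewrite ler_ln ?posrE ?ler_nat ?ltr0n // ltnW.
have Lk : L%:R * ln 2 <= 2 * ln k%:R :> R.
  have h : L.-1%:R * ln 2 <= ln k%:R :> R.
    rewrite mulrC mulr_natr -lnXn // ler_ln ?posrE ?exprn_gt0 ?ltr0n ?(ltnW k1) //.
    by rewrite -natrX ler_nat ltnW // up_log_gtn.
  have -> : L%:R = (L.-1%:R + 1)%R :> R by rewrite natr1 prednK.
  by lra.
have h2 : L%:R <= 2 * ln k%:R / ln 2 :> R by rewrite ler_pdivlMr.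
apply: (@le_trans _ _ (66 * d ^ 2 * k * L)%:R); first by rewrite ler_nat.
apply: (@le_trans _ _ (66 * d%:R ^+ 3 * k%:R * (2 * ln k%:R / ln 2))); last first.
  by rewrite le_eqVlt; apply/orP; left; apply/eqP; field; rewrite gt_eqF.
rewrite !natrM -expr2; apply: ler_pM => //.
  by rewrite !mulr_ge0 ?exprn_ge0.
rewrite ler_wpM2r // ler_wpM2l //.
by apply: ler_weXn2l; rewrite ?ler1n.
Qed.

Section Homogenization.
Context {R : realType} {d : nat}.

Definition homog (x : 'cV[R]_d) : 'rV[R]_d.+1 := (col_mx (1 : 'cV[R]_1) x : 'cV[R]_d.+1)^T.

Lemma homog_ord0 x : homog x 0 ord0 = 1.
Proof. by rewrite !mxE; case: splitP => // i _; rewrite ord1 mxE. Qed.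

Lemma homog_lift x i : homog x 0 (lift ord0 i) = x i 0.
Proof.
rewrite !mxE; case: splitP => [[[|j] //]|j /= e].
by congr (x _ 0); apply: val_inj; move: e; rewrite /= /bump => -[].
Qed.

Lemma orientationE (q : 'I_d.+1 -> 'cV[R]_d) :
  orientation q = Num.sg (\det (\matrix_a homog (q a))).
Proof.
rewrite /orientation -det_tr; congr (Num.sg (\det _)).
by apply/matrixP => a b; rewrite mxE [RHS]mxE [LHS]mxE [RHS]mxE.
Qed.

(** A linear dependency between the coordinates of the rows is the equation of a
hyperplane through the points; its linear part is nonzero, since otherwise the
constant would vanish too. *)
Lemma general_position_det (A : {fset 'cV[R]_d}) (q : 'I_d.+1 -> 'cV[R]_d) :
  general_position A -> injective q -> (forall j, q j \in A) ->
  \det (\matrix_a homog (q a)) != 0.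
Proof.
move=> gpA qinj qA; apply/negP => /eqP D0.
have /det0P [v v0 vM] : \det (\matrix_a homog (q a))^T == 0 by rewrite det_tr D0.
pose S := [fset q j | j in 'I_d.+1].
have qS x : x \in S -> exists j, x = q j by case/imfsetP => j _ ->; exists j.
apply: (gpA S).
- by apply/fsubsetP => x /qS[j ->].
- by rewrite card_imfset // size_enum_ord.
pose a : 'cV[R]_d := \col_i v 0 (lift ord0 i).
have eqn j : (v 0 ord0 + \sum_(i < d) a i 0 * q j i 0 = 0)%R.
  have /rowP/(_ j) := vM; rewrite [LHS]mxE [RHS]mxE => h.
  apply: etrans h; rewrite [RHS]big_ord_recl; congr (_ + _)%R.
    by rewrite 2![in RHS]mxE homog_ord0 mulr1.
  by apply: eq_bigr => i _; rewrite mxE 2![in RHS]mxE homog_lift.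
exists a, (- v 0 ord0); split; last first.
  by move=> x /qS[j ->]; apply/eqP; rewrite -addr_eq0 addrC eqn.
apply: contra v0 => /eqP a0; have v00 : v 0 ord0 = 0.
  by have := eqn 0; rewrite a0 big1 ?addr0 // => i _; rewrite mxE mul0r.
apply/eqP/rowP => i; rewrite mxE; case: (unliftP ord0 i) => [i'|] ->; last by rewrite v00.
by have /colP/(_ i') := a0; rewrite !mxE.
Qed.

Lemma sg_of_weak_sign (b : bool) (x : R) : 0 <= (-1) ^+ b * x -> x != 0 ->
  Num.sg x = (-1) ^+ b.
Proof.
case: b; rewrite ?expr1 ?expr0 ?mul1r ?mulN1r ?oppr_ge0 => h x0.
  by rewrite ltr0_sg // lt_neqAle x0.
by rewrite gtr0_sg // lt_def x0.
Qed.

End Homogenization.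

Theorem theorem1p4 (R : realType) :
  exists C : R, 0 < C /\
    forall (d k : nat) (P : 'I_k -> {fset 'cV[R]_d}),
      (d < k)%N ->
      (forall i j : 'I_k, i != j -> [disjoint P i & P j]) ->
      general_position (\bigcup_(i <- enum 'I_k) P i) ->
      exists P' : 'I_k -> {fset 'cV[R]_d},
        [/\ forall i, P' i `<=` P i,
            same_type_transversals P' &
            forall i : 'I_k,
              2 `^ (- (C * d%:R ^+ 3 * k%:R * ln k%:R)) * #|` P i|%:R
                <= #|` P' i|%:R :> R].
Proof.
have C0 : 0 < 132 / ln 2 :> R by rewrite divr_gt0 // ln_gt0 // ltr1n.
exists (132 / ln 2); split=> // d k P dk disj gp.
have bound_le1 : 2 `^ (- (132 / ln 2 * d%:R ^+ 3 * k%:R * ln k%:R)) <= 1 :> R.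
  apply: (@le_trans _ _ (2 `^ 0)); last by rewrite powRr0.
  rewrite ler_powR ?ler1n // oppr_le0 !mulr_ge0 ?exprn_ge0 ?invr_ge0 ?ln_ge0 ?ler1n //.
  exact: leq_ltn_trans dk.
have whole i : 2 `^ (- (132 / ln 2 * d%:R ^+ 3 * k%:R * ln k%:R)) * #|` P i|%:R
    <= #|` P i|%:R :> R by rewrite ler_piMl.
(* In dimension 0 the exponent is 0, so that the sets must be kept whole; all
points coincide. *)
have [d0|d0] := posnP d.
  exists P; split=> // p q _ _ f _; subst d; congr (Num.sg (\det _)).
  by apply/matrixP => a b; rewrite mxE [RHS]mxE (flatmx0 ((p \o f) b)) (flatmx0 ((q \o f) b)).
have [/existsP[i0 /eqP Pi0]|] := boolP [exists i, P i == fset0].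
  by exists P; split=> // p q /(_ i0); rewrite Pi0.
rewrite negb_exists => /forallP P0.
set A := \bigcup_(i <- enum 'I_k) P i in gp.
have PA i : P i `<=` A by apply: bigfcup_sup; rewrite ?mem_enum.
pose Q0 i : {set A} := [set x | val x \in P i].
have PE i : P i = [fset val x | x in Q0 i].
  apply/fsetP => x; apply/idP/imfsetP => [xP|[y]]; last by rewrite inE => yP ->.
  by exists (FSetSub (fsubsetP (PA i) _ xP)); rewrite ?inE.
have cardE (X : {set A}) : #|` [fset val x | x in X]| = #|X|.
  by rewrite card_imfset ?cardE //; exact: val_inj.
have Q00 i : Q0 i != set0.
  by apply: contra (P0 i) => /eqP e; rewrite -cardfs_eq0 PE cardE e cards0.
have k1 : (1 < k)%N by apply: leq_ltn_trans dk.
have [|s [M [t [M0 hitting few fine ht]]]] :=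
  @sampling_parameters d k (up_log 2 k) d0 dk _ (up_logP _ (ltnSn 1)).
  by rewrite up_log_gt0.
have [Q [QQ0 Qbig Qtype]] :=
  @weak_same_type _ d k A (homog \o val) s M t _ M0 hitting few fine Q0 Q00 (leqnn _).
pose P' (i : 'I_k) : {fset 'cV[R]_d} := [fset val x | x in Q i]; exists P'; split.
- move=> i; rewrite PE; apply/fsubsetP => _ /imfsetP[x xQ ->].
  by apply/imfsetP; exists x => //; exact: (subsetP (QQ0 i)).
- move=> p q pQ qQ f fmono.
  have finj : injective f.
    move=> a b e; apply: ord_inj.
    by case: (ltngtP a b) => // /fmono; rewrite e ltnn.
  have [|b Hb] := Qtype (finfun f); first by move=> a c; rewrite !ffunE; exact: finj.
  (* Disjointness of the sets makes the points of a transversal distinct, so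
  general position applies to them. *)
  have sgE (r : 'I_k -> 'cV[R]_d) : Defs.transversal P' r ->
      orientation (r \o f) = (-1) ^+ b.
    move=> rQ; have ex i : exists2 x, x \in Q i & r i = val x by exact/imfsetP/rQ.
    have [x xQ rx] := fin_all_exists2 ex.
    have rP i : r i \in P i.
      by rewrite PE rx; apply/imfsetP; exists (x i) => //; exact: (subsetP (QQ0 i)).
    rewrite orientationE; apply: sg_of_weak_sign; last first.
      apply: (general_position_det gp) => [a c e|a]; last first.
        exact: (fsubsetP (PA (f a)) _ (rP (f a))).
      apply: finj; apply/eqP; apply: contraT => /disj /fdisjointP/(_ _ (rP _)).
      by rewrite -[r (f a)]/((r \o f) a) e rP.
    have xT : finfun x \in transversals Q by apply/transversalsP => i; rewrite ffunE.
    have := Hb _ xT; congr (is_true (0 <= _ * \det _)).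
    by apply/row_matrixP => a; rewrite !rowK !ffunE /= rx.
  by rewrite (sgE _ pQ) (sgE _ qQ).
- move=> i; rewrite powRN ler_pdivrMl ?powR_gt0 // [X in #|` X|]PE /P' !cardE.
  apply: (@le_trans _ _ (2 ^+ t.+1 * #|Q i|%:R)).
    by rewrite -natrX -natrM ler_nat.
  by rewrite ler_wpM2r // powR_const_bound.
Qed.
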